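(* Let $T:=\{s_{m}^{*}u^{n}e_{k}u^{n'}s_{m'} : m,m',k \in \mathbb{Z}\setminus\{0\},\ n,n' \in \mathbb{Z}\}\cup\{0\}\subset U[\mathbb{Z}]$. Then $T$ is an inverse semigroup of partial isometries (under the multiplication and the involution $*$ of $U[\mathbb{Z}]$). Let $P:=\{u^{n}e_{m}u^{-n} : m\in\mathbb{Z}\setminus\{0\},\ n\in\mathbb{Z}\}\cup\{0\}$. Then the set of projections in $T$ coincides with $P$. Also, the linear span of $T$ is dense in $U[\mathbb{Z}]$.
   Context: $\mathbb{Z}^{\times}$ denotes the set of non-zero integers. $U[\mathbb{Z}]$ is the universal $C^*$-algebra generated by a set of unitaries $\{u^{n}:n\in\mathbb{Z}\}$ and a set of isometries $\{s_{m}:m\in\mathbb{Z}^{\times}\}$ satisfying, for all admissible indices, the relations $s_{m}s_{n}=s_{mn}$, $u^{n}u^{m}=u^{n+m}$, $s_{m}u^{n}=u^{mn}s_{m}$, and $\sum_{n\in\mathbb{Z}/(m)}u^{n}e_{m}u^{-n}=1$, where $e_{m}:=s_{m}s_{m}^{*}$ is the final projection of $s_{m}$. *)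

(* Defs.v *)
From HB Require Import structures.
From mathcomp Require Import all_boot all_order all_algebra.
From mathcomp Require Import all_classical all_reals all_analysis.
From mathcomp Require Import complex.

Set Implicit Arguments.
Unset Strict Implicit.
Unset Printing Implicit Defensive.

Import Order.TTheory GRing.Theory Num.Theory.
Import numFieldNormedType.Exports.

Local Open Scope classical_set_scope.
Local Open Scope complex_scope.
Local Open Scope ring_scope.

(* A nonzero unital C*-algebra: a Banach space with a product, a unit
   and an involution.  The ring structure is part of the record, and is declared
   on [cstar_sort] below, because Hierarchy Builder admits no structure above
   both normed modules and rings: [Num.NumDomain] is already declared as their
   join.  The norm of a normed module over R[i] takes its values in R[i]; they
   are nonnegative, hence real. *)
Record cstarAlgType (R : realType) := CStarAlg {
  cstar_space : completeNormedModType R[i] ;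
  cstar_one : cstar_space ;
  cstar_mul : cstar_space -> cstar_space -> cstar_space ;
  cstar_star : cstar_space -> cstar_space ;
  cstar_mulA : associative cstar_mul ;
  cstar_mul1x : left_id cstar_one cstar_mul ;
  cstar_mulx1 : right_id cstar_one cstar_mul ;
  cstar_mulDl : left_distributive cstar_mul +%R ;
  cstar_mulDr : right_distributive cstar_mul +%R ;
  cstar_one_neq0 : cstar_one != 0 ;
  cstar_scaleAl : forall (a : R[i]) x y,
    a *: cstar_mul x y = cstar_mul (a *: x) y ;
  cstar_scaleAr : forall (a : R[i]) x y,
    a *: cstar_mul x y = cstar_mul x (a *: y) ;
  cstar_starK : involutive cstar_star ;
  cstar_starD : {morph cstar_star : x y / x + y} ;
  cstar_starZ : forall (a : R[i]) x,
    cstar_star (a *: x) = Num.conj a *: cstar_star x ;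
  cstar_starM : forall x y,
    cstar_star (cstar_mul x y) = cstar_mul (cstar_star y) (cstar_star x) ;
  cstar_normM : forall x y, `|cstar_mul x y| <= `|x| * `|y| ;
  cstar_norm : forall x, `|cstar_mul (cstar_star x) x| = `|x| ^+ 2
}.

Definition cstar_sort (R : realType) (A : cstarAlgType R) : Type :=
  cstar_space A.
Coercion cstar_sort : cstarAlgType >-> Sortclass.

Section CStarInstances.
Variables (R : realType) (A : cstarAlgType R).

HB.instance Definition _ :=
  CompleteNormedModule.copy (cstar_sort A) (cstar_space A).

HB.instance Definition _ := GRing.Zmodule_isNzRing.Build (cstar_sort A)
  (@cstar_mulA R A) (@cstar_mul1x R A) (@cstar_mulx1 R A)
  (@cstar_mulDl R A) (@cstar_mulDr R A)
  (@cstar_one_neq0 R A).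

HB.instance Definition _ :=
  GRing.LSemiModule_isLSemiAlgebra.Build R[i] (cstar_sort A) (@cstar_scaleAl R A).

HB.instance Definition _ :=
  GRing.LSemiAlgebra_isSemiAlgebra.Build R[i] (cstar_sort A) (@cstar_scaleAr R A).

Definition star (x : A) : A := cstar_star x.

End CStarInstances.

Reserved Notation "x ^⋆" (at level 1, format "x ^⋆").
Notation "x ^⋆" := (star x) : ring_scope.

Section StarAlgebraNotions.
Variables (R : realType) (A : cstarAlgType R).
Implicit Types (x y p : A) (S : set A).

Definition is_unitary x := x^⋆ * x = 1 /\ x * x^⋆ = 1.

Definition is_isometry x := x^⋆ * x = 1.

Definition is_projection p := p^⋆ = p /\ p * p = p.

Definition is_partial_isometry x := is_projection (x^⋆ * x).

(* Associativity is inherited from [A]. *)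
Definition is_inverse_semigroup S (inv : A -> A) :=
  [/\ forall x y, S x -> S y -> S (x * y),
      forall x, S x -> S (inv x)
    & forall x y, S x -> S y ->
        (x * y * x = x /\ y * x * y = y) <-> y = inv x].

Definition linear_span S : set A :=
  [set x | exists n (c : 'I_n -> R[i]) (t : 'I_n -> A),
     (forall i, S (t i)) /\ x = \sum_(i < n) c i *: t i].

Definition closed_star_subalgebra S :=
  [/\ closed S,
      S 0,
      forall (a : R[i]) x y, S x -> S y -> S (a *: x + y),
      forall x y, S x -> S y -> S (x * y)
    & forall x, S x -> S x^⋆].

Definition cstar_generated_by (G : set A) :=
  forall S, closed_star_subalgebra S -> G `<=` S -> S = setT.

End StarAlgebraNotions.

Definition is_star_hom (R : realType) (A B : cstarAlgType R)
    (f : {lrmorphism A -> B}) :=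
  forall x, f x^⋆ = (f x)^⋆.

Section UZ.
Variable R : realType.

(* [u n] is the unitary written with superscript n.  The isometries are
   indexed by the nonzero integers only: the value [s 0] is arbitrary, and is
   never used below. *)

Definition final_proj (A : cstarAlgType R) (s : int -> A) (m : int) : A :=
  s m * (s m)^⋆.

(* Z/(m) is represented by 0, ..., |m| - 1; the summand depends only on the
   class of n modulo m, as e_m commutes with u^(mk). *)
Definition UZ_relations (A : cstarAlgType R) (u s : int -> A) : Prop :=
  [/\ (forall n, is_unitary (u n)) /\
        (forall m, m != 0 -> is_isometry (s m)),
      forall m n, m != 0 -> n != 0 -> s m * s n = s (m * n),
      forall n m, u n * u m = u (n + m),
      forall m n, m != 0 -> s m * u n = u (m * n) * s m
    & forall m, m != 0 ->
        \sum_(n < `|m|%N) u n%:Z * final_proj s m * u (- n%:Z) = 1].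

Definition UZ_generators (A : cstarAlgType R) (u s : int -> A) : set A :=
  range u `|` s @` [set m | m != 0].

(* [A] with [u] and [s] is the universal C*-algebra U[Z].  Only nonzero [B] are
   tested, but the zero algebra always receives exactly one map; and asking for
   unital homomorphisms is no restriction, as u 0 = 1 by the relations. *)
Definition is_UZ (A : cstarAlgType R) (u s : int -> A) : Prop :=
  [/\ UZ_relations u s,
      cstar_generated_by (UZ_generators u s)
    & forall (B : cstarAlgType R) (u' s' : int -> B), UZ_relations u' s' ->
        let extends (f : {lrmorphism A -> B}) :=
          [/\ is_star_hom f,
              forall n, f (u n) = u' n
            & forall m, m != 0 -> f (s m) = s' m] in
        (exists f, extends f) /\
        (forall f g, extends f -> extends g -> f =1 g)].

Definition UZ_T (A : cstarAlgType R) (u s : int -> A) : set A :=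
  [set x | exists m m' k n n' : int,
     [/\ m != 0, m' != 0, k != 0
       & x = (s m)^⋆ * u n * final_proj s k * u n' * s m']] `|` [set 0].

Definition UZ_P (A : cstarAlgType R) (u s : int -> A) : set A :=
  [set x | exists m n : int,
     m != 0 /\ x = u n * final_proj s m * u (- n)] `|` [set 0].

End UZ.

(* Main.v *)
Require Import Defs.
From HB Require Import structures.
From mathcomp Require Import all_boot all_order all_algebra.
From mathcomp Require Import all_classical all_reals all_analysis.
From mathcomp Require Import complex.
From mathcomp Require Import ring lra.

Set Implicit Arguments.
Unset Strict Implicit.
Unset Printing Implicit Defensive.

Import Order.TTheory GRing.Theory Num.Theory.
Import numFieldNormedType.Exports.

Local Open Scope classical_set_scope.
Local Open Scope ring_scope.

(** Two facts about the relations give everything.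

    Normal form.  Every element of T other than 0 is u^a s_k s_m^⋆ u^b, and
    all these products are in T.  To bring s_m^⋆ u^n s_k to this form, take
    out of m and k their gcd g: the middle factor s_g^⋆ u^n s_g is 0 when g
    does not divide n ([UZ_sandwich_ndvd]), and u^(n/g) otherwise.  In the
    second case the rest of m and of k are coprime, Bezout splits the
    exponent n/g into two parts that leave on either side, and s_m^⋆ commutes
    with s_k for coprime m and k ([UZ_star_s_comm]).  This is
    [UZ_middle]; closure of T under products ([UZ_normal_mul]) follows, and
    for x = u^a s_k s_m^⋆ u^b one reads off that x x^⋆ = u^a e_k u^-a and
    x x^⋆ x = x.  Hence T consists of partial isometries, and a projection
    p = p p^⋆ of T is in P.  In any C*-algebra, a set of partial isometries
    closed under products and adjoints is an inverse semigroup, because in it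
    the idempotents are selfadjoint
    ([partial_isometries_inverse_semigroup]).

    Orthogonality.  The relation 1 = sum_n u^n e_m u^-n is used through the
    orthogonality of its terms, that is s_m^⋆ u^n s_m = 0 when m does not
    divide n.  That isometries v_j with sum_j v_j v_j^⋆ = 1 have orthogonal
    ranges is a positivity statement: v_i^⋆ ( ) v_i turns it into a vanishing
    sum of elements 2 b_j b_j^⋆ with b_j = v_i^⋆ v_j, and positive elements with sum 0 vanish.
    Rather than by spectral theory, this is obtained from norm estimates.
    The elements y_j = 2 b_j b_j^⋆ satisfy || 1 - y_j || <= 1, and averaging
    shows that both 1 + t y_j and 1 - t y_j are in the unit ball for some
    t > 0.  Then t y_j = 0, as 1 is an extreme point of the ball
    ([one_extreme_selfadj]); the C*-identity gives that by comparing two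
    estimates of the norm of 1 + t r^2 for a selfadjoint r
    ([nrm_1Dsqr_ge] and [nrm_1D_mulrn_le]).

    Density is formal: the closure of the span of a set closed under products
    and adjoints is a closed *-subalgebra, and T contains the generators. *)

(** * Real-valued norm and involution of a C*-algebra *)

Section CStarBasics.
Variables (R : realType) (A : cstarAlgType R).
Implicit Types (x y : A) (a b : R).

(** The norm as an element of the real field, where [lra] and [nra] apply. *)
Definition nrm x : R := complex.Re `|x|.

Lemma nrmE x : `|x| = (nrm x)%:C%C.
Proof.
rewrite /nrm; have := normr_ge0 x.
by case: `|x| => a b; rewrite lecE /= => /andP[/eqP-> _].
Qed.

Lemma nrm_ge0 x : 0 <= nrm x.
Proof. by have := normr_ge0 x; rewrite nrmE lecE /= => /andP[]. Qed.

Lemma nrmD x y : nrm (x + y) <= nrm x + nrm y.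
Proof.
by have := ler_normD x y; rewrite !nrmE -(rmorphD (real_complex R)) lecR.
Qed.

Lemma nrmM x y : nrm (x * y) <= nrm x * nrm y.
Proof.
have : `|(x * y : A)| <= `|x| * `|y| := cstar_normM x y.
by rewrite !nrmE -(rmorphM (real_complex R)) lecR.
Qed.

Lemma nrm_scale (c : R[i]) x : nrm (c *: x) = complex.Re `|c| * nrm x.
Proof. by rewrite {1}/nrm normrZ nrmE normc_def /= mulr0 subr0. Qed.

Lemma nrmZ a x : 0 <= a -> nrm (a%:C%C *: x) = a * nrm x.
Proof.
move=> a0; rewrite nrm_scale [`|_|]normc_def /= expr0n addr0 sqrtr_sqr.
by rewrite ger0_norm.
Qed.

Lemma nrmN x : nrm (- x) = nrm x.
Proof. by rewrite /nrm normrN. Qed.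

Lemma nrm0 : nrm 0 = 0.
Proof. by rewrite /nrm normr0. Qed.

Lemma nrm_eq0 x : nrm x = 0 -> x = 0.
Proof. by move=> h; apply/eqP; rewrite -normr_eq0 nrmE h. Qed.

Lemma nrm_star_mul x : nrm (x^⋆ * x) = nrm x ^+ 2.
Proof.
have : `|(x^⋆ * x : A)| = `|x| ^+ 2 := cstar_norm x.
by rewrite !nrmE -(rmorphXn (real_complex R)) => /complexI.
Qed.

Lemma starK x : x^⋆^⋆ = x. Proof. exact: cstar_starK. Qed.
Lemma starD x y : (x + y)^⋆ = x^⋆ + y^⋆. Proof. exact: cstar_starD. Qed.
Lemma starM x y : (x * y)^⋆ = y^⋆ * x^⋆. Proof. exact: cstar_starM. Qed.
Lemma starZ (c : R[i]) x : (c *: x)^⋆ = Num.conj c *: x^⋆.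
Proof. exact: cstar_starZ. Qed.

Lemma starZr a x : (a%:C%C *: x)^⋆ = a%:C%C *: x^⋆.
Proof.
rewrite starZ; congr (_ *: _); apply/eqP.
by rewrite eq_complex /= oppr0 !eqxx.
Qed.

Lemma star0 : (0 : A)^⋆ = 0.
Proof. by apply: (addrI (0^⋆)); rewrite -starD !addr0. Qed.

Lemma starN x : (- x)^⋆ = - x^⋆.
Proof. by apply: (addrI x^⋆); rewrite -starD !subrr star0. Qed.

Lemma star1 : (1 : A)^⋆ = 1.
Proof. by rewrite -[LHS]mul1r -{1}[1]starK -starM mul1r starK. Qed.

Lemma nrm1 : nrm (1 : A) = 1.
Proof.
have := nrm_star_mul 1; rewrite star1 mulr1 => h.
have [n0|n0] := eqVneq (nrm (1 : A)) 0.
  by have /eqP := nrm_eq0 n0; rewrite oner_eq0.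
by apply: (mulfI n0); rewrite mulr1 -expr2 -h.
Qed.

Lemma nrm_star x : nrm x^⋆ = nrm x.
Proof.
have le y : nrm y <= nrm y^⋆.
  have [y0|y0] := eqVneq (nrm y) 0; first by rewrite y0 nrm_ge0.
  have := nrmM y^⋆ y; rewrite nrm_star_mul expr2 ler_pM2r //.
  by rewrite lt_neqAle eq_sym y0 nrm_ge0.
by apply/eqP; rewrite eq_le le -{2}[x]starK le.
Qed.

Lemma star_mul_eq0 x : x^⋆ * x = 0 -> x = 0.
Proof.
by move=> h; apply: nrm_eq0; apply/eqP; rewrite -sqrf_eq0 -nrm_star_mul h nrm0.
Qed.

Lemma nrm_selfadj_sqr x : x^⋆ = x -> nrm (x * x) = nrm x ^+ 2.
Proof. by move=> h; rewrite -nrm_star_mul h. Qed.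

Lemma nrm_isometry x : is_isometry x -> nrm x = 1.
Proof.
move=> h; have := nrm_star_mul x; rewrite h nrm1 => /eqP.
by rewrite eq_sym sqrf_eq1 => /orP[/eqP//|/eqP e]; have := nrm_ge0 x; lra.
Qed.

Lemma nrm_sum (I : finType) (P : pred I) (x : I -> A) :
  nrm (\sum_(i | P i) x i) <= \sum_(i | P i) nrm (x i).
Proof.
elim/big_ind2: _ => [|a x1 b x2 h1 h2|//]; first by rewrite nrm0.
by apply: le_trans (nrmD _ _) _; exact: lerD.
Qed.

End CStarBasics.

(** * Positivity from norm estimates *)

Lemma sqr1B_idem2 (T : pzRingType) (p : T) :
  p * p = p -> (1 - p *+ 2) * (1 - p *+ 2) = 1.
Proof.
move=> pp; rewrite mulrBl mul1r mulrBr mulr1 mulrnAl mulrnAr pp opprB.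
by rewrite [_ *+ 2 *+ 2]mulr2n addrK subrK.
Qed.

Section RingIdentities.
Variables (T : pzRingType) (w : T).

Lemma sqr1DB_sub : (1 + w) * (1 + w) - (1 - w) * (1 - w) = w *+ 4.
Proof.
rewrite [1 + w]addrC -[1 - w]opprB mulrNN -!expr2 sqrrD1 sqrrB1.
rewrite opprD opprB addrACA [X in _ + X]subrr addr0 [RHS](mulrnDr w 2 2).
by move: (w ^+ 2) (w *+ 2) => a b; rewrite [LHS]addrC addrA subrK.
Qed.

Lemma sqr1DB_add : (1 + w) * (1 + w) + (1 - w) * (1 - w) = (1 + w * w) *+ 2.
Proof.
rewrite [1 + w]addrC -[1 - w]opprB mulrNN -!expr2 sqrrD1 sqrrB1 [RHS]mulr2n.
move: (w ^+ 2) (w *+ 2) => a b.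
by rewrite addrACA [X in X + _]addrACA subrr addr0 [RHS]addrACA [RHS]addrC.
Qed.

End RingIdentities.

Section Positivity.
Variables (R : realType) (A : cstarAlgType R).
Implicit Types (x y h k r : A) (s t : R).

(** With z = 1 + ir, the C*-identity reads || z ||^2 = || 1 + r^2 ||, and
    4ir = z^2 - (z^⋆)^2. *)
Lemma nrm_1Dsqr_ge r : r^⋆ = r -> 2 * nrm r <= nrm (1 + r * r).
Proof.
move=> rr; pose z : A := 1 + 'i%C *: r.
have zs : z^⋆ = 1 - 'i%C *: r.
  rewrite /z starD star1 starZ rr -scaleNr; congr (_ + _ *: _).
  by apply/eqP; rewrite eq_complex /= oppr0 !eqxx.
have ii : ('i * 'i : R[i])%C = -1 by rewrite -expr2 sqr_i.
have zz : z^⋆ * z = 1 + r * r.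
  rewrite zs /z mulrDl mul1r mulrDr mulr1 mulNr -scalerAl -scalerAr scalerA ii.
  by rewrite scaleN1r opprK addrA addrK.
have e : z * z - z^⋆ * z^⋆ = 4%:R *: ('i%C *: r).
  by rewrite zs sqr1DB_sub scaler_nat.
have : nrm (4%:R *: ('i%C *: r)) <= 2 * nrm (1 + r * r).
  rewrite -e -zz nrm_star_mul; apply: le_trans (nrmD _ _) _; rewrite nrmN.
  have := nrmM z z; have := nrmM z^⋆ z^⋆; rewrite nrm_star; lra.
have -> : (4%:R : R[i]) = (4%:R : R)%:C%C by rewrite rmorph_nat.
rewrite nrmZ // nrm_scale normc_def /= expr0n expr1n add0r sqrtr1 mul1r; lra.
Qed.

Lemma nrm_convex x s t : 0 <= t <= s -> nrm (1 + s%:C%C *: x) <= 1 ->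
  nrm (1 + t%:C%C *: x) <= 1.
Proof.
move=> /andP[t0]; rewrite le_eqVlt => /predU1P[-> //|ts h].
have s0 : 0 < s by lra.
pose q := t / s; have q0 : 0 <= q by rewrite divr_ge0 // ltW.
have q1 : q <= 1 by rewrite ler_pdivrMr // mul1r ltW.
have -> : 1 + t%:C%C *: x = q%:C%C *: (1 + s%:C%C *: x) + (1 - q)%:C%C *: 1.
  rewrite scalerDr scalerA -(rmorphM (real_complex R)) divfK ?gt_eqF //.
  rewrite addrAC -scalerDl -(rmorphD (real_complex R)).
  by rewrite [q + _]addrC subrK scale1r.
apply: le_trans (nrmD _ _) _; rewrite !nrmZ ?subr_ge0 // nrm1.
by have := ler_wpM2l q0 h; lra.
Qed.

(** As 1 + (n + 1)tk = (1 + ntk)(1 + tk) - nt^2 k^2, each step adds at most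
    n t^2 || k ||^2 to the norm: for small t, the norm of 1 + Tk exceeds 1 by
    a term of second order in T only. *)
Lemma nrm_1D_mulrn_le k t n : 0 <= t -> nrm (1 + t%:C%C *: k) <= 1 ->
  nrm (1 + (n%:R * t)%:C%C *: k) <= 1 + (n%:R * t * nrm k) ^+ 2 / 2.
Proof.
move=> t0 h; elim: n => [|n IHn].
  by rewrite !mul0r scale0r addr0 nrm1 expr0n mul0r addr0.
have -> : 1 + (n.+1%:R * t)%:C%C *: k =
    (1 + (n%:R * t)%:C%C *: k) * (1 + t%:C%C *: k)
    - (n%:R * t * t)%:C%C *: (k * k).
  rewrite mulrDl mul1r mulrDr mulr1 -scalerAl -scalerAr scalerA.
  rewrite -(rmorphM (real_complex R)) addrA addrK -addrA -scalerDl.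
  rewrite -(rmorphD (real_complex R)); congr (1 + _%:C%C *: k).
  by rewrite -natr1 mulrDl mul1r addrC.
apply: le_trans (nrmD _ _) _; rewrite nrmN nrmZ ?mulr_ge0 //.
have := nrmM (1 + (n%:R * t)%:C%C *: k) (1 + t%:C%C *: k).
have kk := nrmM k k; have k0 := nrm_ge0 k; have n0 : (0 : R) <= n%:R by [].
have : nrm (1 + (n%:R * t)%:C%C *: k) * nrm (1 + t%:C%C *: k) <=
  nrm (1 + (n%:R * t)%:C%C *: k) by rewrite ler_piMr ?nrm_ge0.
have := ler_wpM2l (mulr_ge0 (mulr_ge0 n0 t0) t0) kk.
move: IHn; rewrite -[n.+1%:R]natr1.
set N := n%:R; set K := nrm k.
have : 0 <= (t * K) ^+ 2 by exact: sqr_ge0.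
lra.
Qed.

(** At T = 1 / || r ||^2, [nrm_1Dsqr_ge] bounds || 1 + T r^2 || below by 2,
    while [nrm_1D_mulrn_le] bounds it above by 3/2. *)
Lemma nrm_1Dsqr_le1 r s : r^⋆ = r -> 0 < s ->
  nrm (1 + s%:C%C *: (r * r)) <= 1 -> r = 0.
Proof.
move=> rr s0 h; apply: nrm_eq0; apply/eqP; apply/negPn/negP => rN0.
have r0 : 0 < nrm r by rewrite lt_neqAle eq_sym rN0 nrm_ge0.
pose w := (nrm r)^-1; have w0 : 0 < w by rewrite invr_gt0.
have wr : w * nrm r = 1 by rewrite mulVf.
(* [n] is so large that the step [t] = T / [n] is at most [s]. *)
pose n := (Num.truncn (w ^+ 2 / s)).+1; pose t := w ^+ 2 / n%:R.
have nt : n%:R * t = w ^+ 2 by rewrite mulrC divfK ?pnatr_eq0.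
have t0 : 0 <= t by rewrite divr_ge0 ?sqr_ge0.
have ts : t <= s.
  rewrite ler_pdivrMr ?ltr0n // mulrC -ler_pdivrMr //.
  by rewrite ltW // truncnS_gt.
have ht : nrm (1 + t%:C%C *: (r * r)) <= 1.
  by apply: nrm_convex h; rewrite t0 ts.
have := nrm_1D_mulrn_le n t0 ht; rewrite nt nrm_selfadj_sqr // -exprMn wr.
have -> : (w ^+ 2)%:C%C *: (r * r) = (w%:C%C *: r) * (w%:C%C *: r).
  by rewrite -scalerAl -scalerAr scalerA expr2 (rmorphM (real_complex R)).
have := @nrm_1Dsqr_ge (w%:C%C *: r); rewrite starZr rr => /(_ erefl).
rewrite nrmZ; last exact: ltW.
by rewrite wr !expr1n; lra.
Qed.

(** The mean of the contractions (1 + h)^2 and (1 - h)^2 is 1 + h^2. *)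
Lemma one_extreme_selfadj h :
  h^⋆ = h -> nrm (1 + h) <= 1 -> nrm (1 - h) <= 1 -> h = 0.
Proof.
move=> hh hp hm; apply: (@nrm_1Dsqr_le1 h 1) => //.
have -> : 1 + 1%:C%C *: (h * h) =
    (2^-1 : R)%:C%C *: ((1 + h) * (1 + h) + (1 - h) * (1 - h)).
  rewrite sqr1DB_add -scalerMnr scalerMnl -(rmorphMn (real_complex R)).
  by rewrite -[2^-1 *+ 2]mulr_natr mulVf // !scale1r.
rewrite nrmZ ?invr_ge0 //.
have := nrmD ((1 + h) * (1 + h)) ((1 - h) * (1 - h)).
have := nrmM (1 + h) (1 + h); have := nrmM (1 - h) (1 - h).
have := nrm_ge0 (1 + h); have := nrm_ge0 (1 - h); nra.
Qed.

End Positivity.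

Section CuntzOrthogonality.
Variables (R : realType) (A : cstarAlgType R).

(** Selfadjoint elements of the unit ball centred at 1 stand for positive
    elements here.  If n other terms sum to - y_j, then 1 + y_j / (n + 1) is
    the mean of 1 and of the n contractions 1 - y_i. *)
Lemma sum_ball1_eq0 (I : finType) (P : pred I) (y : I -> A) :
  (forall i, P i -> (y i)^⋆ = y i /\ nrm (1 - y i) <= 1) ->
  \sum_(i | P i) y i = 0 -> forall i, P i -> y i = 0.
Proof.
move=> hy sum0 j Pj; have [yj hj] := hy j Pj.
pose n := #|[pred i | P i && (i != j)]|; pose t : R := n.+1%:R^-1.
have t0 : 0 < t by rewrite invr_gt0 ltr0n.
have t1 : t <= 1 by rewrite invf_le1 ?ltr0n // ler1n.
have tn : t * n%:R + t = 1.
  by rewrite -{2}[t]mulr1 -mulrDr natr1 mulVf ?pnatr_eq0.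
suff ty : t%:C%C *: y j = 0.
  move/eqP: ty; rewrite scaler_eq0 => /orP[/eqP/complexI t00|/eqP//].
  by move: t0; rewrite t00 ltxx.
apply: one_extreme_selfadj; first by rewrite starZr yj.
  have -> : 1 + t%:C%C *: y j =
      t%:C%C *: (1 + \sum_(i | P i && (i != j)) (1 - y i)).
    have -> : \sum_(i | P i && (i != j)) (1 - y i) = 1 *+ n + y j.
      rewrite sumrB sumr_const; congr (_ + _).
      by apply/eqP; rewrite eqr_oppLR -addr_eq0 addrC -bigD1 // sum0.
    rewrite addrA -mulrS scalerDr; congr (_ + _).
    rewrite -scalerMnr scalerMnl -(rmorphMn (real_complex R)).
    by rewrite -mulr_natr mulVf ?pnatr_eq0 // scale1r.
  rewrite nrmZ; last exact: ltW.
  rewrite -[leRHS]tn -[X in _ <= _ + X]mulr1 -mulrDr ler_pM2l //.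
  apply: le_trans (nrmD _ _) _; rewrite nrm1 addrC lerD2r.
  apply: le_trans (nrm_sum _ _) _.
  rewrite -[leRHS]mulr1 mulr_natl -sumr_const.
  by apply: ler_sum => i /andP[/hy[]].
have hj' : nrm (1 + 1%:C%C *: - y j) <= 1 by rewrite scale1r.
by rewrite -scalerN; apply: nrm_convex hj'; rewrite ltW.
Qed.

(** Compressing sum_j v_j v_j^⋆ = 1 by v_i cancels the term j = i.  The other
    terms are positive in the sense of [sum_ball1_eq0], once doubled, because
    1 - 2p is a unitary for every projection p. *)
Lemma isometry_ranges_orthogonal (N : nat) (v : 'I_N -> A) :
  (forall i, is_isometry (v i)) -> \sum_i v i * (v i)^⋆ = 1 ->
  forall i j, i != j -> (v i)^⋆ * v j = 0.
Proof.
move=> vI sum1 i j ij.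
pose y j := ((v i)^⋆ * (v j * (v j)^⋆) * v i) *+ 2.
suff y0 : y j = 0.
  have x0 : (v j)^⋆ * v i = 0.
    apply: star_mul_eq0; rewrite starM starK mulrA -(mulrA _ (v j)).
    move/eqP: y0; rewrite /y -(@scaler_nat R[i]) scaler_eq0 pnatr_eq0.
    by move=> /eqP.
  by rewrite -[LHS]starK starM starK x0 star0.
apply: (@sum_ball1_eq0 _ (predC1 i)) => /=; last 1 first.
- by rewrite eq_sym.
- move=> k ki; split.
    by rewrite /y mulr2n starD !starM !starK !mulrA.
  pose p := v k * (v k)^⋆.
  have ps : p^⋆ = p by rewrite starM starK.
  have pp : p * p = p by rewrite /p mulrA -(mulrA (v k)) vI mulr1.
  have np : nrm (1 - p *+ 2) = 1.
    apply: nrm_isometry; rewrite /is_isometry starD star1 starN mulr2n starD ps.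
    by rewrite -mulr2n sqr1B_idem2.
  have -> : 1 - y k = (v i)^⋆ * (1 - p *+ 2) * v i.
    by rewrite mulrBr mulrBl mulr1 vI mulrnAr mulrnAl.
  apply: le_trans (nrmM _ _) _; rewrite (nrm_isometry (vI i)) mulr1.
  apply: le_trans (nrmM _ _) _.
  by rewrite nrm_star (nrm_isometry (vI i)) np mulr1.
- rewrite /y sumrMnl -mulr_suml -mulr_sumr.
  have -> : \sum_(k | k != i) v k * (v k)^⋆ = 1 - v i * (v i)^⋆.
    move: sum1; rewrite (bigD1 i) //= => <-.
    by rewrite [X in _ = X - _]addrC addrK.
  by rewrite mulrBr mulr1 mulrA vI mul1r subrr mul0r mul0rn.
Qed.

End CuntzOrthogonality.

(** * Semigroups of partial isometries *)

Section InverseSemigroup.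
Variables (R : realType) (A : cstarAlgType R) (S : set A).
Hypothesis SM : forall x y, S x -> S y -> S (x * y).
Hypothesis Sstar : forall x, S x -> S x^⋆.
Hypothesis SP : forall x, S x -> x * x^⋆ * x = x.

(** If pq is a partial isometry then pqpq = pq, so that z = pq(1 - p) has
    z z^⋆ = 0: thus pq = pqp, which is selfadjoint. *)
Lemma mul_proj_comm p q : S p -> S q -> is_projection p -> is_projection q ->
  p * q = q * p.
Proof.
move=> Sp Sq [ps pp] [qs qq].
have pqpq : p * q * p * q = p * q.
  have := SP (SM Sp Sq); rewrite starM ps qs.
  by rewrite !mulrA -(mulrA p q q) qq -(mulrA _ p p) pp.
have z0 : (p * q - p * q * p)^⋆ = 0.
  apply: star_mul_eq0; rewrite starK starD starN !starM ps qs.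
  rewrite mulrBl !mulrBr !mulrA -!(mulrA _ q q) qq -!(mulrA _ p p) pp.
  by rewrite pqpq !subrr.
have e : p * q = p * q * p.
  by apply/eqP; rewrite -subr_eq0 -[X in X == _]starK z0 star0.
by have := congr1 (@star R A) e; rewrite !starM ps qs mulrA -e => ->.
Qed.

Lemma partial_isometry_proj (x : A) : x * x^⋆ * x = x ->
  is_projection (x^⋆ * x) /\ is_projection (x * x^⋆).
Proof.
move=> h; split; split; rewrite ?starM ?starK //.
  by rewrite -mulrA (mulrA x) h.
by rewrite mulrA h.
Qed.

Lemma partial_isometry_star (x : A) : x * x^⋆ * x = x -> x^⋆ * x * x^⋆ = x^⋆.
Proof. by move=> /(congr1 (@star R A)); rewrite !starM starK mulrA. Qed.

(** As f^⋆ is idempotent too, f^⋆ = f^⋆ f f^⋆ = (f^⋆ f)(f f^⋆), and exchanging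
    the two projections gives f f^⋆ f^⋆ f = f f^⋆ f = f. *)
Lemma idempotent_selfadj f : S f -> f * f = f -> f^⋆ = f.
Proof.
move=> Sf ff; have fff := SP Sf.
have [Pq Pp] := partial_isometry_proj fff.
have ffs : f^⋆ * f^⋆ = f^⋆ by rewrite -starM ff.
have fsf := partial_isometry_star fff.
have -> : f^⋆ = (f^⋆ * f) * (f * f^⋆) by rewrite mulrA -(mulrA _ f f) ff fsf.
rewrite (mul_proj_comm _ _ Pq Pp); [|by apply: SM => //; apply: Sstar..].
by rewrite mulrA -(mulrA f) ffs fff.
Qed.

Lemma partial_isometries_inverse_semigroup : is_inverse_semigroup S (@star R A).
Proof.
split => // x y Sx Sy; have xxx := SP Sx; split=> [[xyx yxy]|->].
  have xy : (x * y)^⋆ = x * y.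
    by apply: idempotent_selfadj; [exact: SM|rewrite mulrA xyx].
  have yx : (y * x)^⋆ = y * x.
    by apply: idempotent_selfadj; [exact: SM|rewrite mulrA yxy].
  have xyE : x * y = x * x^⋆.
    have e : x * y = (x * x^⋆) * (x * y) by rewrite mulrA xxx.
    by rewrite -xy e starM xy starM starK mulrA xyx.
  have yxE : y * x = x^⋆ * x.
    have e : y * x = (y * x) * (x^⋆ * x) by rewrite mulrA -(mulrA y) -mulrA xxx.
    by rewrite -yx e starM yx starM starK -mulrA [x * _]mulrA xyx.
  by rewrite -yxy yxE -mulrA xyE mulrA partial_isometry_star.
by split=> //; exact: partial_isometry_star.
Qed.

End InverseSemigroup.

(** * Consequences of the relations *)

Section Relations.
Variables (R : realType) (A : cstarAlgType R) (u s : int -> A).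
Hypothesis rel : UZ_relations u s.
Implicit Types (m n k a b : int).

Lemma UZ_uD m n : u m * u n = u (m + n).
Proof. by case: rel. Qed.

Lemma UZ_u0 : u 0 = 1.
Proof.
have [[uU _] _ _ _ _] := rel; have [h _] := uU 0.
by rewrite -[u 0]mul1r -{1}h -mulrA UZ_uD addr0.
Qed.

Lemma UZ_ustar n : (u n)^⋆ = u (- n).
Proof.
have [[uU _] _ _ _ _] := rel; have [h _] := uU n.
by rewrite -[LHS]mulr1 -UZ_u0 -(addrN n) -UZ_uD mulrA h mul1r.
Qed.

Lemma UZ_sI m : m != 0 -> (s m)^⋆ * s m = 1.
Proof. by case: rel => -[_ sI] _ _ _ _; exact: sI. Qed.

Lemma UZ_sM m n : m != 0 -> n != 0 -> s m * s n = s (m * n).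
Proof. by have [_ h _ _ _] := rel; exact: h. Qed.

Lemma UZ_s1 : s 1 = 1.
Proof.
have n1 : (1 : int) != 0 by [].
by rewrite -[LHS]mul1r -{1}(UZ_sI n1) -mulrA UZ_sM // mulr1 UZ_sI.
Qed.

Lemma UZ_su m n : m != 0 -> s m * u n = u (m * n) * s m.
Proof. by have [_ _ _ h _] := rel; exact: h. Qed.

Lemma UZ_us_star m n : m != 0 -> u n * (s m)^⋆ = (s m)^⋆ * u (m * n).
Proof.
move=> m0; have /(congr1 (@star R A)) := UZ_su (- n) m0.
by rewrite !starM !UZ_ustar mulrN !opprK.
Qed.

Lemma UZ_sandwich_dvd m n : m != 0 -> (s m)^⋆ * u (m * n) * s m = u n.
Proof. by move=> m0; rewrite -UZ_us_star // -mulrA UZ_sI // mulr1. Qed.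

(** Modulo m, n is a nonzero remainder r, and s_m and u^r s_m are two of the
    isometries whose ranges sum to 1. *)
Lemma UZ_sandwich_ndvd m n : m != 0 -> ~~ (m %| n)%Z ->
  (s m)^⋆ * u n * s m = 0.
Proof.
move=> m0 mn; have [_ _ _ _ /(_ m m0) sum1] := rel.
pose v (i : 'I_`|m|%N) := u i%:Z * s m.
have vI i : is_isometry (v i).
  rewrite /is_isometry /v starM UZ_ustar mulrA -(mulrA (s m)^⋆) UZ_uD addNr.
  by rewrite UZ_u0 mulr1 UZ_sI.
have vsum : \sum_i v i * (v i)^⋆ = 1.
  rewrite -[RHS]sum1; apply: eq_bigr => i _.
  by rewrite /v /final_proj starM UZ_ustar !mulrA.
have m_gt0 : (0 < `|m|)%N by rewrite absz_gt0.
have r_lt : (`|n %% m|%Z < `|m|)%N.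
  by rewrite -ltz_nat gez0_abs ?modz_ge0 // abszE ltz_mod.
have r_neq0 : Ordinal m_gt0 != Ordinal r_lt.
  by rewrite -val_eqE /= eq_sym absz_eq0; apply: contra mn => /eqP/dvdz_mod0P.
have := isometry_ranges_orthogonal vI vsum r_neq0.
rewrite /v starM UZ_ustar /= oppr0 UZ_u0 mulr1 gez0_abs ?modz_ge0 // => h.
rewrite (divz_eq n m) addrC -UZ_uD mulrC.
by rewrite -!mulrA -UZ_su // (mulrA (u _) (s m)) (mulrA (s m)^⋆) h mul0r.
Qed.

Lemma UZ_s_comm m k : m != 0 -> k != 0 -> s m * s k = s k * s m.
Proof. by move=> m0 k0; rewrite !UZ_sM // mulrC. Qed.

(** Insert 1 = sum_i u^i e_m u^-i on the right of s_m^⋆ s_k: the i-th term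
    contains s_m^⋆ u^(ki) s_m, which vanishes for 0 < i < |m| as m is prime
    to k, and the term i = 0 is s_k s_m^⋆. *)
Lemma UZ_star_s_comm m k : m != 0 -> k != 0 -> coprimez m k ->
  (s m)^⋆ * s k = s k * (s m)^⋆.
Proof.
move=> m0 k0 mk; have [_ _ _ _ /(_ m m0) sum1] := rel.
have m_gt0 : (0 < `|m|)%N by rewrite absz_gt0.
rewrite -[LHS]mulr1 -sum1 mulr_sumr (bigD1 (Ordinal m_gt0)) //= big1.
  rewrite oppr0 UZ_u0 /final_proj mulr1 mul1r addr0.
  by rewrite mulrA -(mulrA (s m)^⋆) -UZ_s_comm // mulrA UZ_sI // mul1r.
move=> i i0; rewrite /final_proj !mulrA -(mulrA _ (s k)) UZ_su // mulrA.
rewrite -(mulrA _ (s k)) -UZ_s_comm // mulrA UZ_sandwich_ndvd ?mul0r //.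
rewrite Gauss_dvdzr //; apply: contra i0; rewrite dvdzE /= => mi.
rewrite -val_eqE /=; apply: contraLR mi; rewrite -lt0n => i0.
by rewrite gtnNdvd.
Qed.

(** The rule that moves an adjoint s_m^⋆ to the right of an s_k. *)
Lemma UZ_middle m n k : m != 0 -> k != 0 ->
  (s m)^⋆ * u n * s k = 0 \/
  exists m1 k1 a b, [/\ m1 != 0, k1 != 0 &
    (s m)^⋆ * u n * s k = u a * s k1 * (s m1)^⋆ * u b].
Proof.
move=> m0 k0; pose g := gcdz m k.
have g0 : g != 0 by rewrite /g gcdz_eq0 negb_and m0.
have [m1 def_m] := dvdzP (dvdz_gcdl m k).
have [k1 def_k] := dvdzP (dvdz_gcdr m k).
have m10 : m1 != 0 by apply: contraNneq m0 => m10; rewrite def_m m10 mul0r.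
have k10 : k1 != 0 by apply: contraNneq k0 => k10; rewrite def_k k10 mul0r.
have e : (s m)^⋆ * u n * s k = (s m1)^⋆ * ((s g)^⋆ * u n * s g) * s k1.
  have -> : s m = s g * s m1 by rewrite UZ_sM // mulrC -def_m.
  have -> : s k = s g * s k1 by rewrite UZ_sM // mulrC -def_k.
  by rewrite starM !mulrA.
rewrite {}e; have [gn|gn] := boolP (g %| n)%Z; last first.
  by left; rewrite UZ_sandwich_ndvd // mulr0 mul0r.
right; have [n1 ->] := dvdzP gn.
rewrite [n1 * g]mulrC UZ_sandwich_dvd //.
have [x [y xy]] := Bezoutz m k.
have xy1 : x * m1 + y * k1 = 1.
  apply: (mulIf g0); rewrite mul1r mulrDl -!mulrA -def_m -def_k.
  exact: xy.
have cop : coprimez m1 k1 by apply/coprimezP; exists (x, y).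
exists m1, k1, (n1 * x), (n1 * y); split=> //.
have n1E : n1 = m1 * (n1 * x) + k1 * (n1 * y).
  by rewrite -[LHS]mulr1 -xy1; ring.
rewrite {1}n1E -UZ_uD mulrA -UZ_us_star // -mulrA -UZ_su // !mulrA.
by rewrite -(mulrA (u _)) UZ_star_s_comm // mulrA.
Qed.

Definition UZ_normal : set A :=
  [set x | exists k m a b : int,
     [/\ k != 0, m != 0 & x = u a * s k * (s m)^⋆ * u b]] `|` [set 0].

Lemma UZ_normal_star x : UZ_normal x -> UZ_normal x^⋆.
Proof.
case=> [[k [m [a [b [k0 m0 ->]]]]]|->]; last by right; rewrite star0.
left; exists m, k, (- b), (- a); split=> //.
by rewrite !starM !starK !UZ_ustar !mulrA.
Qed.

Lemma UZ_normal_mul x y : UZ_normal x -> UZ_normal y -> UZ_normal (x * y).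
Proof.
case=> [[k [m [a [b [k0 m0 ->]]]]]|->]; last by right; rewrite mul0r.
case=> [[k' [m' [a' [b' [k'0 m'0 ->]]]]]|->]; last by right; rewrite mulr0.
have -> : u a * s k * (s m)^⋆ * u b * (u a' * s k' * (s m')^⋆ * u b') =
    u a * s k * ((s m)^⋆ * u (b + a') * s k') * (s m')^⋆ * u b'.
  by rewrite -UZ_uD !mulrA.
have [->|[m1 [k1 [c [d [m10 k10 ->]]]]]] := UZ_middle (b + a') m0 k'0.
  by right; rewrite mulr0 !mul0r.
left; exists (k * k1), (m' * m1), (a + k * c), (m' * d + b').
split; rewrite ?mulf_neq0 //.
rewrite -!UZ_uD -!UZ_sM // starM !mulrA.
rewrite -(mulrA (u a) (s k)) UZ_su // -!mulrA.
congr (_ * (_ * (_ * (_ * (_ * _))))).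
by rewrite !mulrA UZ_us_star.
Qed.

Lemma UZ_normal_middle m n k :
  m != 0 -> k != 0 -> UZ_normal ((s m)^⋆ * u n * s k).
Proof.
move=> m0 k0; have [->|] := UZ_middle n m0 k0; first by right.
by move=> [m1 [k1 [a [b [m10 k10 ->]]]]]; left; exists k1, m1, a, b.
Qed.

Lemma UZ_TE : UZ_T u s = UZ_normal.
Proof.
apply/seteqP; split=> x.
  case=> [[m [m' [k [n [n' [m0 m'0 k0 ->]]]]]]|->]; last by right.
  have -> : (s m)^⋆ * u n * final_proj s k * u n' * s m' =
      ((s m)^⋆ * u n * s k) * ((s k)^⋆ * u n' * s m').
    by rewrite /final_proj !mulrA.
  by apply: UZ_normal_mul; exact: UZ_normal_middle.
case=> [[k [m [a [b [k0 m0 ->]]]]]|->]; last by right.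
(* Writing u^a = s_m^⋆ u^(ma) s_m and u^b = s_k^⋆ u^(kb) s_k puts s_m before
   s_k s_m^⋆ and s_k^⋆ after it, which makes it e_(mk). *)
left; exists m, k, (m * k), (m * a), (k * b); split; rewrite ?mulf_neq0 //.
have -> : final_proj s (m * k) = s m * s k * ((s m)^⋆ * (s k)^⋆).
  by rewrite /final_proj -UZ_sM // -starM -UZ_s_comm.
rewrite !mulrA UZ_sandwich_dvd // -(mulrA _ (s k)^⋆).
by rewrite -(mulrA _ ((s k)^⋆ * _)) UZ_sandwich_dvd.
Qed.

Lemma UZ_normal_range_proj k m a b : m != 0 ->
  let x := u a * s k * (s m)^⋆ * u b in
  x * x^⋆ = u a * final_proj s k * u (- a).
Proof.
move=> m0 x; rewrite /x /final_proj !starM starK !UZ_ustar !mulrA.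
rewrite -(mulrA _ (u b)) UZ_uD addrN UZ_u0 mulr1.
by rewrite -(mulrA _ (s m)^⋆) UZ_sI // mulr1.
Qed.

Lemma UZ_normal_partial_isometry x : UZ_normal x -> x * x^⋆ * x = x.
Proof.
case=> [[k [m [a [b [k0 m0 ->]]]]]|->]; last by rewrite mulr0.
rewrite UZ_normal_range_proj // /final_proj !mulrA.
rewrite -(mulrA _ (u (- a))) UZ_uD addNr UZ_u0 mulr1.
by rewrite -(mulrA _ (s k)^⋆) UZ_sI // mulr1.
Qed.

(** A projection p of T is p p^⋆, which [UZ_normal_range_proj] computes. *)
Lemma UZ_projections : [set p | UZ_T u s p /\ is_projection p] = UZ_P u s.
Proof.
rewrite UZ_TE; apply/seteqP; split=> p.
  case=> Vp [ps pp]; rewrite -pp -{2}ps.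
  case: Vp => [[k [m [a [b [k0 m0 ->]]]]]|->]; last by right; rewrite mul0r.
  by left; exists k, a; rewrite UZ_normal_range_proj.
case=> [[m [n [m0 ->]]]|->]; last by split; [right|split; rewrite ?star0 ?mulr0].
have e := @UZ_normal_range_proj m m n (- n) m0; split.
  by left; exists m, m, n, (- n); rewrite /final_proj !mulrA.
rewrite -e; apply: (partial_isometry_proj _).2; apply: UZ_normal_partial_isometry.
by left; exists m, m, n, (- n).
Qed.

End Relations.

(** * Density of the span *)

Section Density.
Variables (R : realType) (A : cstarAlgType R).
Implicit Types (S T : set A).

Lemma nrm_closureP S x :
  closure S x <-> forall e : R, 0 < e -> exists2 y, S y & nrm (x - y) < e.
Proof.
split=> [cl e e0|h B /nbhs_normP [e /= e0 eB]].
  have e0' : 0 < e%:C%C :> R[i] by rewrite ltcR.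
  have [y [Sy]] := cl _ (nbhsx_ballx x (PosNum e0')%:num e0').
  by rewrite -ball_normE /= nrmE ltcR => xy; exists y.
have e1 : 0 < complex.Re e by move: e0; rewrite ltcE /= => /andP[].
have [y Sy xy] := h _ e1; exists y; split=> //; apply: eB => /=.
rewrite nrmE; move: e0 xy; case: e {e1} => a b; rewrite !ltcE /=.
by move=> /andP[/eqP -> _] ->; rewrite eqxx.
Qed.

Lemma linear_span_lin T (a : R[i]) x y :
  linear_span T x -> linear_span T y -> linear_span T (a *: x + y).
Proof.
move=> [n [c [t [Tt ->]]]] [m [d [w [Tw ->]]]].
exists (n + m)%N,
  (fun i => match fintype.split i with inl j => a * c j | inr j => d j end),
  (fun i => match fintype.split i with inl j => t j | inr j => w j end); split.
  by move=> i; case: fintype.split.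
rewrite big_split_ord /= scaler_sumr; congr (_ + _); apply: eq_bigr => i _.
  by rewrite (unsplitK (inl i)) scalerA.
by rewrite (unsplitK (inr i)).
Qed.

Lemma linear_span0 T : linear_span T 0.
Proof.
exists 0%N, (fun=> 0), (fun=> 0); split; first by case.
by rewrite big_ord0.
Qed.

Lemma linear_spanZ T (a : R[i]) x : linear_span T x -> linear_span T (a *: x).
Proof.
move=> Tx; rewrite -[_ *: _]addr0.
by apply: linear_span_lin => //; exact: linear_span0.
Qed.

Lemma linear_span_sum T n (x : 'I_n -> A) :
  (forall i, linear_span T (x i)) -> linear_span T (\sum_i x i).
Proof.
move=> Tx; elim/big_ind: _ => [|y z Ty Tz|//]; first exact: linear_span0.
by rewrite -[y]scale1r; exact: linear_span_lin.
Qed.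

Lemma sub_linear_span T : T `<=` linear_span T.
Proof.
move=> t Tt; exists 1%N, (fun=> 1), (fun=> t); split=> //.
by rewrite big_ord1 scale1r.
Qed.

Lemma linear_spanM T : (forall x y, T x -> T y -> T (x * y)) ->
  forall x y, linear_span T x -> linear_span T y -> linear_span T (x * y).
Proof.
move=> TM _ _ [n [c [t [Tt ->]]]] [m [d [w [Tw ->]]]].
rewrite mulr_suml; apply: linear_span_sum => i.
rewrite mulr_sumr; apply: linear_span_sum => j.
rewrite -scalerAl -scalerAr; do 2!apply: linear_spanZ.
by apply: sub_linear_span; exact: TM.
Qed.

Lemma linear_span_star T : (forall x, T x -> T x^⋆) ->
  forall x, linear_span T x -> linear_span T x^⋆.
Proof.
move=> TS _ [n [c [t [Tt ->]]]].
have -> : (\sum_(i < n) c i *: t i)^⋆ = \sum_(i < n) (c i *: t i)^⋆.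
  by apply: (big_morph (@star R A)); [exact: starD|exact: star0].
apply: linear_span_sum => i; rewrite starZ; apply: linear_spanZ.
by apply: sub_linear_span; exact: TS.
Qed.

Lemma closed_star_subalgebra_closure S :
  S 0 -> (forall (a : R[i]) x y, S x -> S y -> S (a *: x + y)) ->
  (forall x y, S x -> S y -> S (x * y)) -> (forall x, S x -> S x^⋆) ->
  closed_star_subalgebra (closure S).
Proof.
move=> S0 Slin SM SS; split.
- exact: closed_closure.
- exact: subset_closure.
- move=> a x y /nrm_closureP cx /nrm_closureP cy; apply/nrm_closureP => e e0.
  have na : 0 <= complex.Re `|a|.
    by have := normr_ge0 a; rewrite lecE => /andP[].
  have h1 : 0 < complex.Re `|a| + 1 by lra.
  have e2 : 0 < e / 2 / (complex.Re `|a| + 1) by rewrite !divr_gt0.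
  have e3 : 0 < e / 2 by rewrite divr_gt0.
  have [x' Sx' xx'] := cx _ e2; have [y' Sy' yy'] := cy _ e3.
  exists (a *: x' + y'); first exact: Slin.
  have -> : a *: x + y - (a *: x' + y') = a *: (x - x') + (y - y').
    by rewrite scalerBr opprD addrACA.
  apply: le_lt_trans (nrmD _ _) _; rewrite nrm_scale.
  move: xx'; rewrite ltr_pdivlMr // => xx'.
  by have := nrm_ge0 (x - x'); nra.
- move=> x y /nrm_closureP cx /nrm_closureP cy; apply/nrm_closureP => e e0.
  have x0 := nrm_ge0 x; have y0 := nrm_ge0 y.
  (* As d < e, (|| x || + d) d + d || y || is less than
     d (|| x || + || y || + e + 1) = e. *)
  pose d := e / (nrm x + nrm y + e + 1).
  have D0 : 0 < nrm x + nrm y + e + 1 by lra.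
  have d0 : 0 < d by rewrite divr_gt0.
  have dE : d * (nrm x + nrm y + e + 1) = e by rewrite divfK // gt_eqF.
  have [x' Sx' xx'] := cx _ d0; have [y' Sy' yy'] := cy _ d0.
  exists (x' * y'); first exact: SM.
  have -> : x * y - x' * y' = (x - x') * y + x' * (y - y').
    by rewrite mulrBl mulrBr addrA subrK.
  have nx' : nrm x' <= nrm x + d.
    have -> : x' = x - (x - x') by rewrite opprB addrC subrK.
    by apply: le_trans (nrmD _ _) _; rewrite nrmN; lra.
  apply: le_lt_trans (nrmD _ _) _.
  have := nrmM (x - x') y; have := nrmM x' (y - y').
  have := nrm_ge0 x'; have := nrm_ge0 (x - x'); have := nrm_ge0 (y - y').
  have : nrm (x - x') * nrm y <= d * nrm y by rewrite ler_wpM2r // ltW.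
  have : nrm x' * nrm (y - y') <= (nrm x + d) * d.
    by apply: ler_pM; rewrite ?nrm_ge0 // ltW.
  have : d < e.
    by rewrite ltr_pdivrMr // -{1}[e]mulr1 ltr_pM2l //; lra.
  by nra.
- move=> x /nrm_closureP cx; apply/nrm_closureP => e e0.
  have [x' Sx' xx'] := cx _ e0; exists x'^⋆; first exact: SS.
  by rewrite -starN -starD nrm_star.
Qed.

Lemma dense_linear_span G T : cstar_generated_by G -> G `<=` T ->
  (forall x y, T x -> T y -> T (x * y)) -> (forall x, T x -> T x^⋆) ->
  dense (linear_span T).
Proof.
move=> gen GT TM TS.
have clT : closure (linear_span T) = setT.
  apply: gen => [|x /GT Tx]; last by apply/subset_closure/sub_linear_span.
  apply: closed_star_subalgebra_closure; first exact: linear_span0.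
  - exact: linear_span_lin.
  - exact: linear_spanM.
  - exact: linear_span_star.
move=> O [x Ox] Oopen; have : closure (linear_span T) x by rewrite clT.
by move=> /(_ O (open_nbhs_nbhs (conj Oopen Ox))); rewrite setIC.
Qed.

End Density.

(** * The inverse semigroup T *)

Theorem proposition2p11 (R : realType) (A : cstarAlgType R) (u s : int -> A)
    (hA : is_UZ u s) :
  [/\ is_inverse_semigroup (UZ_T u s) (@star R A),
      forall x, UZ_T u s x -> is_partial_isometry x,
      [set p | UZ_T u s p /\ is_projection p] = UZ_P u s
    & dense (linear_span (UZ_T u s))].
Proof.
have [rel gen _] := hA.
have SM := UZ_normal_mul rel; have Sstar := UZ_normal_star rel.
have SP := UZ_normal_partial_isometry rel.
rewrite UZ_projections // (UZ_TE rel); split=> //.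
- exact: partial_isometries_inverse_semigroup.
- by move=> x /SP/partial_isometry_proj[].
- apply: (dense_linear_span gen) => // x [[n _ <-]|[m m0 <-]]; left.
    exists 1, 1, n, 0; split=> //.
    by rewrite (UZ_s1 rel) (UZ_u0 rel) star1 !mulr1.
  exists m, 1, 0, 0; split=> //.
  by rewrite (UZ_s1 rel) (UZ_u0 rel) star1 mul1r !mulr1.
Qed.
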